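(* Let $D\ge 3$ and $n\ge 1$ be integers, let $B_1,\dots,B_n$ be $D$-coloured graphs, and write $2p_i=\#V(B_i)$. Put $$\Delta_{N,D}(B_1,\dots,B_n):=N^{(D-1)n-D}\int^{\mathrm{conn.}}_{(\mathbb C^N)^{\otimes D}}\prod_{i=1}^n B_i(T)\,\mathrm d\mu_0(T)\;-\;N^{2n-3}\int^{\mathrm{conn.}}_{(\mathbb C^N)^{\otimes 3}}\prod_{i=1}^n \mathsf u_{p_i}(T)\,\mathrm d\mu_0(T).$$ If $B_1,\dots,B_n$ are all melonic, then $$\lim_{N\to\infty}\Delta_{N,D}(B_1,\dots,B_n)=0.$$ In particular, for any integer $\tilde D\ge 3$, if $\tilde B_1,\dots,\tilde B_n$ are melonic $\tilde D$-coloured graphs with $\#V(\tilde B_i)=2p_i$ for all $i$, then $$\lim_{N\to\infty}\Big\{N^{(D-1)n-D}\int^{\mathrm{conn.}}_{(\mathbb C^N)^{\otimes D}}B_1(T)\cdots B_n(T)\,\mathrm d\mu_0(T)-N^{(\tilde D-1)n-\tilde D}\int^{\mathrm{conn.}}_{(\mathbb C^N)^{\otimes\tilde D}}\tilde B_1(T)\cdots\tilde B_n(T)\,\mathrm d\mu_0(T)\Big\}=0.$$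
   Context: Coloured graphs. A $D$-coloured graph is a finite non-empty graph (multiple edges allowed), vertex-bipartite into black and white vertices, with edges coloured by $\{1,\dots,D\}$ so that every vertex is incident to exactly one edge of each colour. $V(G)$ denotes the vertex set of a graph $G$. A disjoint union of $D$-coloured graphs is again a $D$-coloured graph. Wick contractions and faces. A Wick contraction $\pi$ of a $D$-coloured graph $B$ is a bijection between its black and its white vertices, regarded as a set of pairs $(v,w)$ with $v$ black and $w$ white. $\pi(B)$ is the $(D+1)$-coloured graph (colours $0,1,\dots,D$) obtained from $B$ by adding one edge of colour $0$ between $v$ and $w$ for each $(v,w)\in\pi$. A face of $\pi(B)$ of colour $c\in\{1,\dots,D\}$ is a connected component of the subgraph formed by all edges of colours $0$ and $c$; $F(\pi(B))$ is the set of all faces, over all $c\in\{1,\dots,D\}$. Connected Gaussian integral. To a $D$-coloured graph $B$ corresponds the polynomial $B(T)$ in the entries $T_{i_1,\dots,i_D}$ of a tensor $T\in(\mathbb C^N)^{\otimes D}$ and their complex conjugates, obtained by placing $T$ at each white and $\overline T$ at each black vertex and summing, for each edge of colour $c$, over a common value in $\{1,\dots,N\}$ of the $c$-th indices at its two endpoints. $\mathrm d\mu_0$ is the complex Gaussian measure on $(\mathbb C^N)^{\otimes D}$ with $\mathbb E[T_{i_1\dots i_D}\overline T_{j_1\dots j_D}]=N^{-(D-1)}\delta_{i_1j_1}\cdots\delta_{i_Dj_D}$. The connected integral of a product of connected graphs is by definition the part of Wick's expansion coming from connected graphs: $$\int^{\mathrm{conn.}}_{(\mathbb C^N)^{\otimes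 D}}B_1(T)\cdots B_n(T)\,\mathrm d\mu_0(T):=\sum_{\pi}N^{\#F(\pi(\dot\cup_iB_i))-\frac{D-1}{2}\#V(\dot\cup_iB_i)},$$ where the sum is over all Wick contractions $\pi$ of the disjoint union $\dot\cup_{i=1}^nB_i$ for which $\pi(\dot\cup_iB_i)$ is connected. Dipoles. A dipole of colour $c$ is a black vertex $v$ and a white vertex $w$ joined by $D-1$ edges, one of each colour in $\{1,\dots,D\}\setminus\{c\}$, together with a half-edge of colour $c$ at each of $v,w$. Inserting it at a $c$-coloured edge $e$ of a $D$-coloured graph, with black endpoint $x$ and white endpoint $y$, means deleting $e$ and adding $c$-coloured edges joining $x$ to $w$ and $v$ to $y$. Melonic graphs. Let $\mathcal T$ be a finite rooted tree in which every non-leaf vertex has exactly $D$ children, the edges to them being coloured bijectively by $1,\dots,D$; let $p\ge1$ be the number of non-leaf vertices, labelled $0,2,\dots,2p-2$ so that each has a larger label than its parent. Let $B^{(0)}$ be the $D$-coloured graph with two vertices, $0$ (black) and $1$ (white), joined by $D$ edges. For $n=1,\dots,p-1$, if the tree vertex $2n$ is the child along colour $c$ of the tree vertex $2m$, then $B^{(n)}$ is obtained from $B^{(n-1)}$ by inserting a dipole of colour $c$ at the $c$-coloured edge incident to vertex $2m$; the new vertices are labelled $2n$ (black) and $2n+1$ (white). Put $B(\mathcal T)=B^{(p-1)}$. A $D$-coloured graph is melonic if it is isomorphic to some $B(\mathcal T)$; melonic graphs are connected. Universal graphs. $\mathsf u_p$ ($p\ge1$) is the $3$-coloured graph with $2p$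 vertices obtained from the two-vertex $3$-coloured graph by $p-1$ successive insertions of dipoles of colour $1$. *)

(* Defs.v *)
From HB Require Import structures.
From mathcomp Require Import all_boot all_order all_algebra.
From mathcomp Require Import all_classical all_reals all_analysis.

Set Implicit Arguments.
Unset Strict Implicit.
Unset Printing Implicit Defensive.

Import Order.TTheory GRing.Theory Num.Theory.
Import numFieldNormedType.Exports.

Local Open Scope ring_scope.

(* The unique edge of colour c at the black vertex v goes to the white vertex
   edge c v; that every white vertex also carries exactly one edge of colour c
   is the bijectivity of edge c.  The colours 1, ..., D are the elements of
   'I_D, shifted by one. *)
Record cgraph (D : nat) : Type := CGraph {
  black : finType;
  white : finType;
  edge : 'I_D -> black -> white;
  edge_bij : forall c, bijective (edge c);
  cgraph_nonempty : (0 < #|{: black + white}|)%N }.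

Arguments edge {D} c0 c v : rename.

Definition vertex (D : nat) (G : cgraph D) : finType :=
  (black G + white G)%type.

Definition adj (D : nat) (G : cgraph D) (S : pred 'I_D) : rel (vertex G) :=
  fun x y => match x, y with
  | inl v, inr w | inr w, inl v => [exists c, S c && (edge G c v == w)]
  | _, _ => false
  end.

Lemma adj_sym (D : nat) (G : cgraph D) (S : pred 'I_D) : symmetric (@adj D G S).
Proof. by case=> [v|w] [v'|w']. Qed.

Definition connected_graph (D : nat) (G : cgraph D) : bool :=
  [forall x : vertex G, forall y : vertex G, connect (adj xpredT) x y].

Definition cgraph_iso (D : nat) (G H : cgraph D) : Prop :=
  exists (f : black G -> black H) (g : white G -> white H),
    [/\ bijective f, bijective g &
        forall c v, edge H c (f v) = g (edge G c v)].

Section DisjointUnion.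
Variables (D n : nat) (hn : (0 < n)%N) (B : 'I_n -> cgraph D).

Definition dunion_edge (c : 'I_D) (v : {i : 'I_n & black (B i)}) :
    {i : 'I_n & white (B i)} :=
  Tagged (fun i => white (B i)) (edge (B (tag v)) c (tagged v)).

Lemma dunion_edge_bij c : bijective (dunion_edge c).
Proof.
have gP i : {g : white (B i) -> black (B i)
             | cancel (edge (B i) c) g & cancel g (edge (B i) c)}.
  by apply/cid2; case: (edge_bij (B i) c) => g ? ?; exists g.
pose g i := s2val (gP i).
exists (fun w : {i : 'I_n & white (B i)} =>
          Tagged (fun i => black (B i)) (g (tag w) (tagged w))).
- by case=> i v; rewrite /dunion_edge /= /g; case: (gP i) => /= h hK _; rewrite hK.
- by case=> i w; rewrite /dunion_edge /= /g; case: (gP i) => /= h _ hK; rewrite hK.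
Qed.

Lemma dunion_nonempty :
  (0 < #|{: {i : 'I_n & black (B i)} + {i : 'I_n & white (B i)}}|)%N.
Proof.
have /card_gt0P[[v|w] _] := cgraph_nonempty (B (Ordinal hn)); apply/card_gt0P.
- by exists (inl (Tagged (fun i => black (B i)) v)).
- by exists (inr (Tagged (fun i => white (B i)) w)).
Qed.

Definition dunion : cgraph D := CGraph dunion_edge_bij dunion_nonempty.

End DisjointUnion.

Section Wick.
Variables (D : nat) (B : cgraph D).

Definition is_wick (pi : {ffun black B -> white B}) : bool :=
  injectiveb pi && [forall w, w \in codom pi].

Definition wick : finType := {f : {ffun black B -> white B} | is_wick f}.

Lemma wick_bij (pi : wick) : bijective (val pi).
Proof.
case: pi => pi /= /andP[/injectiveP inj_pi /forallP surj_pi].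
apply: inj_card_bij => //; rewrite -(card_codom inj_pi).
by apply: subset_leq_card; apply/fintype.subsetP => w _; apply: surj_pi.
Qed.

(* Colour 0 is ord0, and the colour c of B becomes lift ord0 c. *)
Definition contract_edge (pi : wick) (c : 'I_D.+1) : black B -> white B :=
  if unlift ord0 c is Some c' then edge B c' else val pi.

Lemma contract_edge_bij pi c : bijective (contract_edge pi c).
Proof.
rewrite /contract_edge; case: unliftP => [c' _|_]; first exact: edge_bij.
exact: wick_bij.
Qed.

Definition contract (pi : wick) : cgraph D.+1 :=
  CGraph (contract_edge_bij pi) (cgraph_nonempty B).

End Wick.

Definition num_faces (D : nat) (G : cgraph D.+1) : nat :=
  \sum_(c < D) n_comp (@adj _ G (pred2 ord0 (lift ord0 c))) predT.

(* The integral of the product of the B i is, by definition, the part of its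
   Wick expansion that comes from the connected graphs. *)
Definition conn_integral (R : realType) (N D n : nat) (hn : (0 < n)%N)
    (B : 'I_n -> cgraph D) : R :=
  let U := dunion hn B in
  \sum_(pi : wick U | connected_graph (contract pi))
     N%:R `^ ((num_faces (contract pi))%:R
              - (D%:R - 1) / 2%:R * #|vertex U|%:R).

Section TwoVertex.
Variable D : nat.

Lemma two_vertex_bij (c : 'I_D) : bijective (fun _ : unit => tt).
Proof. by exists id; case. Qed.

Lemma two_vertex_nonempty : (0 < #|{: unit + unit}|)%N.
Proof. by rewrite card_sum card_unit. Qed.

Definition two_vertex : cgraph D := CGraph two_vertex_bij two_vertex_nonempty.

End TwoVertex.

(* Insertion of a dipole of colour c at the c-coloured edge whose black
   endpoint is x; the two new vertices are the two None's. *)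
Section Dipole.
Variables (D : nat) (G : cgraph D) (c : 'I_D) (x : black G).

Definition dipole_edge (c' : 'I_D) (v : option (black G)) :
    option (white G) :=
  if c' == c then
    match v with
    | None => Some (edge G c x)
    | Some v => if v == x then None else Some (edge G c v)
    end
  else omap (edge G c') v.

Lemma dipole_edge_bij c' : bijective (dipole_edge c').
Proof.
case: (edge_bij G c') => g gK Kg; rewrite /dipole_edge.
case: eqVneq => [Ec | _]; last first.
  by exists (omap g) => [[v|]|[w|]] //=; rewrite ?gK ?Kg.
rewrite Ec in gK Kg; exists (fun w => match w with
  | None => Some x
  | Some w => if g w == x then None else Some (g w) end).
- case=> [v|] /=; last by rewrite gK eqxx.
  by have [->|/negPf vx] := eqVneq v x; rewrite ?gK ?vx.
- case=> [w|] /=; last by rewrite eqxx.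
  by have [<-|/negPf wx] := eqVneq (g w) x; rewrite ?wx Kg.
Qed.

Lemma dipole_nonempty :
  (0 < #|{: option (black G) + option (white G)}|)%N.
Proof. by apply/card_gt0P; exists (inl None). Qed.

Definition insert_dipole : cgraph D := CGraph dipole_edge_bij dipole_nonempty.

End Dipole.

Inductive tree (D : nat) : Type :=
  | Leaf
  | Node of ('I_D -> tree D).

Arguments Leaf {D}.
Arguments Node {D} _.

Section Melonic.
Variable D : nat.

(* A vertex of a tree is addressed by the sequence of the colours of the edges
   leading from it up to the root: [::] is the root, and c :: a is the child of
   a along colour c.  Addresses that are not in the tree are sent to Leaf. *)
Fixpoint subtree (T : tree D) (a : seq 'I_D) : tree D :=
  match a with
  | [::] => T
  | c :: a' => if subtree T a' is Node f then f c else Leaf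
  end.

Definition nonleaf (T : tree D) (a : seq 'I_D) : bool :=
  if subtree T a is Node _ then true else false.

(* s lists the non-leaf vertices of T by increasing label: nth [::] s n is the
   one labelled 2n. *)
Definition labelling (T : tree D) (s : seq (seq 'I_D)) : Prop :=
  [/\ uniq s,
      forall a, (a \in s) = nonleaf T a &
      forall c a, c :: a \in s -> (index a s < index (c :: a) s)%N].

(* A graph together with the map that sends the tree vertex labelled 2n to the
   black vertex labelled 2n; its values at the tree vertices whose black vertex
   has not been inserted yet are irrelevant. *)
Definition marked_graph := {G : cgraph D & seq 'I_D -> black G}.

Definition melon0 : marked_graph :=
  existT (fun G : cgraph D => seq 'I_D -> black G) (two_vertex D) (fun=> tt).

Definition melon_step (M : marked_graph) (a : seq 'I_D) : marked_graph :=
  if a is c :: b then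
    existT (fun G : cgraph D => seq 'I_D -> black G)
      (insert_dipole c (projT2 M b))
      (fun a' => if a' == a then None else Some (projT2 M a'))
  else M.

Definition melon_graph (s : seq (seq 'I_D)) : cgraph D :=
  projT1 (foldl melon_step melon0 (behead s)).

Definition melonic (B : cgraph D) : Prop :=
  exists (T : tree D) (s : seq (seq 'I_D)),
    [/\ (0 < size s)%N, labelling T s & cgraph_iso (melon_graph s) B].

End Melonic.

(* The universal graph u_p, for p >= 1.  Each dipole is inserted at the edge of
   colour 1 at the most recent black vertex; the automorphism group of u_p is
   transitive on its edges of colour 1, so that another choice of edges gives
   an isomorphic graph. *)
Definition universal_marked (k : nat) : {G : cgraph 3 & black G} :=
  iter k (fun M => existT (fun G : cgraph 3 => black G)
                     (insert_dipole ord0 (projT2 M)) None)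
       (existT (fun G : cgraph 3 => black G) (two_vertex 3) tt).

Definition universal (p : nat) : cgraph 3 := projT1 (universal_marked p.-1).

Definition Delta (R : realType) (N D n : nat) (hn : (0 < n)%N)
    (B : 'I_n -> cgraph D) (p : 'I_n -> nat) : R :=
  N%:R `^ ((D%:R - 1) * n%:R - D%:R) * conn_integral R N hn B
  - N%:R `^ (2%:R * n%:R - 3%:R)
    * conn_integral R N hn (fun i => universal (p i)).

(* Main.v *)
Require Import Defs.
From HB Require Import structures.
From mathcomp Require Import all_boot all_order all_fingroup all_algebra.
From mathcomp Require Import all_classical all_reals all_analysis.
From mathcomp Require Import zify ring lra.

Set Implicit Arguments.
Unset Strict Implicit.
Unset Printing Implicit Defensive.

Import Order.TTheory GRing.Theory Num.Theory.
Import numFieldNormedType.Exports.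

(** A melonic graph is built by inserting dipoles, and each insertion creates one
    black and one white vertex together; pairing these two gives a canonical
    bijection between the black and the white vertices.  Identify both kinds of
    vertices with one set [X] through it.  Then the edges of colour [c] become a
    permutation [tau_c] of [X], a Wick contraction becomes a permutation [b] of
    [X], and the faces of colour [c] become the cycles of [tau_c * b] (first
    [tau_c], then [b]).  A dipole of colour [c] inserted at [x] multiplies
    [tau_c] by the transposition of [x] with a new point, so the graph is encoded
    by a word of triples (colour, [x], new point).

    Write [|s|] for the number of points minus the number of cycles of [s].  For
    a disjoint union of [n] melonic graphs with [P] black vertices in all, the
    word has [P - n] letters.  The number of faces is [D * P] minus
    [L := sum_c |tau_c * b|], so after multiplication by [N ^ ((D - 1) n - D)] a
    connected [b] contributes [N] to the power [P - n + D (n - 1) - L].  The heart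
    of the proof, [dipole_word_bound], says that this exponent is never positive
    and that it vanishes exactly when [|b| = n - 1].  It is an induction on the
    word that removes the last dipole: if its two vertices are not joined by [b],
    then joining them raises the face count in each of the [D - 1] other colours,
    and can lower it by at most one in colour [c].  As [D >= 3], the face count
    strictly increases, unless the graph falls apart into two components; in that
    case colour [c] gains a face as well, which is what the bound on two
    components allows.  Because of this case the bound is proved for all [b],
    with the number of components measured by the rank of a graph.

    So the rescaled integral tends to the number of [b] that connect the [n]
    blocks and satisfy [|b| = n - 1] ([conn_integral_limit]).  This count sees the
    sizes [p i] of the blocks and nothing else of the graphs, not even [D].
    Melonic graphs in any dimension and the universal graphs therefore have the
    same limit, and the differences tend to 0. *)

(** * Permutation length and multiplication by a transposition *)

Section CycleLength.
Local Open Scope group_scope.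
Variable X : finType.
Implicit Types (s : {perm X}) (x y : X).

(** The least number of transpositions with product [s]; it does not change when
    [X] is enlarged by fixed points. *)
Definition perm_length s : nat := #|X| - #|porbits s|.

Lemma leq_card_porbits s : #|porbits s| <= #|X|.
Proof. exact: leq_imset_card. Qed.

Lemma porbits_mulr_tperm s x y :
  #|porbits (s * tperm x y)| + (x \notin porbit s y).*2
  = #|porbits s| + (x != y).
Proof.
rewrite -porbitsV invMg tpermV -[porbits s]porbitsV -(porbitV s).
exact: porbits_mul_tperm.
Qed.

Lemma porbits_tpermC s x y :
  #|porbits (tperm x y * s)| = #|porbits (s * tperm x y)|.
Proof.
apply: (@addIn (x \notin porbit s y).*2).
by rewrite porbits_mul_tperm porbits_mulr_tperm.
Qed.

Lemma perm_length_tpermC s x y :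
  perm_length (tperm x y * s) = perm_length (s * tperm x y).
Proof. by rewrite /perm_length porbits_tpermC. Qed.

Lemma perm_length_merge s x y :
  x \notin porbit s y -> perm_length (s * tperm x y) = (perm_length s).+1.
Proof.
move=> xy; have xNy: x != y.
  by apply: contraNneq xy => ->; apply: porbit_id.
have := porbits_mulr_tperm s x y; rewrite xy xNy /perm_length.
have := leq_card_porbits s; have := leq_card_porbits (s * tperm x y); lia.
Qed.

Lemma leq_perm_length_tperm s x y :
  perm_length s <= (perm_length (s * tperm x y)).+1.
Proof.
have := porbits_mulr_tperm s x y; rewrite /perm_length.
have := leq_card_porbits s; have := leq_card_porbits (s * tperm x y); lia.
Qed.

Lemma fixed_notin_porbit s x y : s x = x -> x != y -> x \notin porbit s y.
Proof.
move=> sx xy; rewrite porbit_sym; apply/porbitP => -[i /eqP].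
by rewrite permX (iter_fix _ sx) eq_sym (negPf xy).
Qed.

Lemma perm_length1 : perm_length 1 = 0.
Proof.
rewrite /perm_length /porbits card_imset ?subnn // => x y /eqP.
rewrite eq_porbit_mem => xy; apply/eqP/negPn/negP => xNy.
by have := fixed_notin_porbit (perm1 x) xNy; rewrite xy.
Qed.

End CycleLength.

(** * Rank of a graph

    The number of components of a graph on [X] is [#|X|] minus the dimension of
    the space spanned by the differences [e_x - e_y] over its edges.  Working with
    this dimension turns the effect of adding an edge into [dim_add_line]. *)

Section EdgeSpace.
Import GRing.Theory.
Local Open Scope ring_scope.
Variable X : finType.
Local Notation V := {ffun X -> rat^o}.
Implicit Types (b : {perm X}) (x y z v : X).

Definition basis_vec x : V := [ffun z => (z == x)%:R].
Definition edge_vec x y : V := basis_vec x - basis_vec y.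

Lemma edge_vec_trans x y z : edge_vec x y + edge_vec y z = edge_vec x z.
Proof. by rewrite /edge_vec addrA subrK. Qed.

Lemma edge_vecxx x : edge_vec x x = 0. Proof. exact: subrr. Qed.

Lemma edge_vecN x y : - edge_vec x y = edge_vec y x. Proof. exact: opprB. Qed.

Definition pairing_fun (w : V) (u : V) : rat^o := \sum_z w z * u z.

Lemma pairing_linear w : linear (pairing_fun w).
Proof.
move=> a u v; rewrite /pairing_fun scaler_sumr -big_split.
apply: eq_bigr => z _; rewrite !ffunE /= mulrDr; congr (_ + _).
exact: mulrCA.
Qed.

HB.instance Definition _ w :=
  GRing.isLinear.Build rat V rat^o _ (pairing_fun w) (pairing_linear w).

(** The subspaces are bounded from above by linear functionals: one that picks a
    coordinate isolates a vertex, the constant one detects the constant sum 0. *)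
Definition annihilator (w : V) : {vspace V} := lker (linfun (pairing_fun w)).

Lemma edge_vec_annihilator w x y :
  (edge_vec x y \in annihilator w) = (w x == w y).
Proof.
have E z : pairing_fun w (basis_vec z) = w z.
  rewrite /pairing_fun (bigD1 z) //= ffunE eqxx mulr1 big1 ?addr0 // => t tz.
  by rewrite ffunE (negPf tz) mulr0.
by rewrite memv_ker lfunE /= linearB /= !E subr_eq0.
Qed.

Lemma dim_add_line (U : {vspace V}) (w : V) :
  \dim (U + <[w]>) = (\dim U + (w \notin U))%N.
Proof.
case: (boolP (w \in U)) => wU /=.
  by rewrite addn0; congr (\dim _); apply/addv_idPl; rewrite -memvE.
have w0: w != 0 by apply: contraNneq wU => ->; rewrite mem0v.
rewrite dimv_disjoint_sum ?dim_vline ?w0 //.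
apply/eqP; rewrite -subv0; apply/subvP => u; rewrite memv_cap => /andP[uU].
case/vlineP => k uE; have [k0|k0] := eqVneq k 0.
  by rewrite uE k0 scale0r mem0v.
by case/negP: wU; rewrite -(scalerK k0 w) -uE memvZ.
Qed.

Definition arc_space b : {vspace V} :=
  <<[seq edge_vec z (b z) | z <- enum X]>>%VS.

Lemma mem_arc_space b x : edge_vec x (b x) \in arc_space b.
Proof. by apply/memv_span/map_f; rewrite mem_enum. Qed.

Lemma arc_space_sub b (U : {vspace V}) :
  (forall x, edge_vec x (b x) \in U) -> (arc_space b <= U)%VS.
Proof. by move=> h; apply/span_subvP => _ /mapP[x _ ->]. Qed.

(** Two points of one cycle are joined by the path along the cycle, which
    telescopes. *)
Lemma porbit_arc_space b x y : x \in porbit b y -> edge_vec x y \in arc_space b.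
Proof.
case/porbitP => i ->; elim: i => [|i IH]; first by rewrite perm1 edge_vecxx mem0v.
rewrite expgSr permM -(edge_vec_trans _ ((b ^+ i) y)%g); apply: memvD => //.
by rewrite -edge_vecN memvN mem_arc_space.
Qed.

Lemma arc_space_tperm_sub b x y :
  (arc_space (b * tperm x y)%g <= arc_space b + <[edge_vec x y]>)%VS.
Proof.
apply: arc_space_sub => z; rewrite permM -(edge_vec_trans _ (b z)).
apply: memv_add; first exact: mem_arc_space.
case: tpermP => [->|->|_ _]; rewrite ?memv_line ?edge_vecxx ?mem0v //.
by rewrite -edge_vecN memvN memv_line.
Qed.

(** [b * tperm v (b v)] is [b] with [v] cut out of its cycle, so [b] is recovered
    from it by the single additional edge from [v] to [b v]. *)
Lemma arc_space_split b v :
  (arc_space b = arc_space (b * tperm v (b v))%g + <[edge_vec v (b v)]>)%VS.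
Proof.
apply: subv_anti; apply/andP; split.
  set t := tperm _ _; rewrite {1}(_ : b = (b * t) * t)%g.
    exact: arc_space_tperm_sub.
  by rewrite -mulgA tperm2 mulg1.
rewrite subv_add -memvE mem_arc_space andbT.
apply: subv_trans (arc_space_tperm_sub _ _ _) _.
by rewrite subv_add subvv -memvE mem_arc_space.
Qed.

Lemma arc_space_fixed b v :
  b v = v -> (arc_space b <= annihilator (basis_vec v))%VS.
Proof.
move=> bv; apply: arc_space_sub => x; rewrite edge_vec_annihilator !ffunE.
by rewrite -{2}bv (inj_eq perm_inj).
Qed.

Lemma fixed_edge_vec_notin b v y :
  b v = v -> v != y -> edge_vec v y \notin arc_space b.
Proof.
move=> bv vy; apply/negP => /(subvP (arc_space_fixed bv)).
by rewrite edge_vec_annihilator !ffunE eqxx [y == v]eq_sym (negPf vy).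
Qed.

Lemma mul_tperm_fixed b v : (b * tperm v (b v))%g v = v.
Proof. by rewrite permM tpermR. Qed.

(** Cutting a moved point out of its cycle lowers the length by one, and it lowers
    the dimension by one because that point becomes isolated. *)
Lemma dim_arc_space b : \dim (arc_space b) = perm_length b.
Proof.
have [k] := ubnP (perm_length b); elim: k b => // k IH b lbk.
case: (pickP (fun v => b v != v)) => [v bv|fixb].
  have vb: v != b v by rewrite eq_sym.
  have fb := mul_tperm_fixed b v.
  have lb: perm_length b = (perm_length (b * tperm v (b v))%g).+1.
    rewrite -(perm_length_merge (fixed_notin_porbit fb vb)).
    by rewrite -mulgA tperm2 mulg1.
  rewrite (arc_space_split b v) dim_add_line fixed_edge_vec_notin //.
  rewrite IH ?lb ?addn1 //.
  by rewrite -ltnS -lb.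
have b1: b = 1%g by apply/permP => x; rewrite perm1; apply/eqP/negPn; rewrite fixb.
rewrite b1 perm_length1; apply/eqP; rewrite dimv_eq0 -subv0.
apply: arc_space_sub => x.
by rewrite perm1 edge_vecxx mem0v.
Qed.

(** A spanning set of differences gives the whole hyperplane of vectors with
    coordinate sum 0. *)
Lemma dim_connected (U : {vspace V}) (x0 : X) :
    (forall x y, edge_vec x y \in U) -> (U <= annihilator [ffun=> 1])%VS ->
  (\dim U).+1 = #|X|.
Proof.
move=> Uall Usum.
have dim_full: \dim (fullv : {vspace V}) = #|X|.
  by rewrite dimvf /dim /= /dim /= muln1.
have x0U : basis_vec x0 \notin U.
  apply/negP => /(subvP Usum); rewrite memv_ker lfunE /= /pairing_fun.
  rewrite (bigD1 x0) //= big1 => [|z zx]; rewrite !ffunE ?(negPf zx) ?mulr0 //.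
  by rewrite eqxx mulr1 addr0 oner_eq0.
rewrite -dim_full -(addn1 (\dim U)) -[1%N]/(true : nat) -x0U -dim_add_line.
congr (\dim _); apply: subv_anti; rewrite subvf /=; apply/subvP => u _.
have -> : u = \sum_z u z *: basis_vec z.
  apply/ffunP => z; rewrite sum_ffunE (bigD1 z) //= big1 => [|y yz].
    by rewrite !ffunE eqxx addr0 /GRing.scale /= mulr1.
  by rewrite !ffunE eq_sym (negPf yz) scaler0.
apply: memv_suml => z _; apply: memvZ.
rewrite -(subrK (basis_vec x0) (basis_vec z)).
exact: memv_add (Uall z x0) (memv_line _).
Qed.

End EdgeSpace.

(** * Words of dipoles and the bound on the number of faces *)

Section DipoleWords.
Local Open Scope group_scope.
Variables (D : nat) (X : finType).
Local Notation dipole := ('I_D * X * X)%type.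
Implicit Types (s : seq dipole) (b : {perm X}).

Definition fresh_vertex (v : X) s :=
  all (fun t => (v != t.1.2) && (v != t.2)) s.

(** A letter [(c, x, v)] is a dipole of colour [c] inserted at [x] whose new vertex
    is [v]; the dipole inserted last stands first. *)
Fixpoint dipole_word s : bool :=
  if s is t :: s'
  then [&& t.1.2 != t.2, fresh_vertex t.2 s' & dipole_word s'] else true.

(** The insertion makes the edge of colour [c] at [x] lead to the partner of [v],
    and the one at [v] lead to the former neighbour of [x]: this is the
    composition of a transposition, applied first, with the former permutation. *)
Definition colour_perm s (c : 'I_D) : {perm X} :=
  \prod_(t <- s | t.1.1 == c) tperm t.1.2 t.2.

Definition graph_space s b : {vspace {ffun X -> rat^o}} :=
  (<<[seq edge_vec t.1.2 t.2 | t <- s]>> + arc_space b)%VS.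

Lemma colour_perm_cons t s c :
  colour_perm (t :: s) c =
  (if t.1.1 == c then tperm t.1.2 t.2 * colour_perm s c else colour_perm s c).
Proof. by rewrite /colour_perm big_cons. Qed.

Lemma colour_perm_fixed s c v : fresh_vertex v s -> colour_perm s c v = v.
Proof.
rewrite /colour_perm; elim: s => [|t s IH] /=; first by rewrite big_nil perm1.
case/andP => /andP[v1 v2] /IH vs; rewrite big_cons; case: ifP => // _.
by rewrite permM tpermD // eq_sym.
Qed.

Lemma graph_space_fixed s b v : b v = v -> fresh_vertex v s ->
  (graph_space s b <= annihilator (basis_vec v))%VS.
Proof.
move=> bv fv; rewrite subv_add arc_space_fixed // andbT.
apply/span_subvP => _ /mapP[t ts ->]; rewrite edge_vec_annihilator !ffunE.
have /andP[/negPf v1 /negPf v2] := allP fv t ts.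
by rewrite ![_ == v]eq_sym v1 v2.
Qed.

Lemma colour_arc_mem s b c x :
  edge_vec x (colour_perm s c x) \in graph_space s b.
Proof.
apply: (subvP (addvSl _ _)); rewrite /colour_perm.
elim: s x => [|t s IH] x; first by rewrite big_nil perm1 edge_vecxx mem0v.
have sub : (<<[seq edge_vec u.1.2 u.2 | u <- s]>> <=
            <<[seq edge_vec u.1.2 u.2 | u <- t :: s]>>)%VS.
  by apply: sub_span => w ws; rewrite inE ws orbT.
rewrite big_cons; case: ifP => _; last exact: (subvP sub).
rewrite permM -(edge_vec_trans _ (tperm t.1.2 t.2 x)); apply: memvD; last first.
  exact: (subvP sub).
have dt : edge_vec t.1.2 t.2 \in <<[seq edge_vec u.1.2 u.2 | u <- t :: s]>>%VS.
  by apply: memv_span; rewrite inE eqxx.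
case: tpermP => [->|->|_ _] //; last by rewrite edge_vecxx mem0v.
by rewrite -edge_vecN memvN.
Qed.

Lemma perm_arc_mem s b x : edge_vec x (b x) \in graph_space s b.
Proof. exact: (subvP (addvSr _ _)) (mem_arc_space _ _). Qed.

Lemma porbit_graph_space s b c x y :
  x \in porbit (colour_perm s c * b) y -> edge_vec x y \in graph_space s b.
Proof.
move/porbit_arc_space; apply: subvP; apply: arc_space_sub => z.
rewrite permM -(edge_vec_trans _ (colour_perm s c z)).
by rewrite memvD ?colour_arc_mem ?perm_arc_mem.
Qed.

Lemma graph_space_augmentation s b :
  (graph_space s b <= annihilator [ffun=> 1%R])%VS.
Proof.
rewrite subv_add; apply/andP; split; last first.
  by apply: arc_space_sub => x; rewrite edge_vec_annihilator !ffunE.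
by apply/span_subvP => _ /mapP[t _ ->]; rewrite edge_vec_annihilator !ffunE.
Qed.

Lemma graph_space_split s b v :
  (graph_space s b
   = graph_space s (b * tperm v (b v))%g + <[edge_vec v (b v)]>)%VS.
Proof. by rewrite /graph_space {1}(arc_space_split b v) addvA. Qed.

(** [#|X|] minus the number of components of the graph with word [s] and the
    contraction [b]. *)
Definition graph_rank s b := \dim (graph_space s b).

Lemma graph_rank_cons t s b :
  t.1.2 != t.2 -> b t.2 = t.2 -> fresh_vertex t.2 s ->
  graph_rank (t :: s) b = (graph_rank s b).+1.
Proof.
move=> xv bv fv; rewrite /graph_rank {1}/graph_space /= span_cons -addvA addvC.
rewrite dim_add_line -/(graph_space s b).
suff -> : edge_vec t.1.2 t.2 \notin graph_space s b by rewrite addn1.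
apply/negP => /(subvP (graph_space_fixed bv fv)).
by rewrite edge_vec_annihilator !ffunE eqxx (negPf xv).
Qed.

(** With [K] for the rank and [m] for the size of [s], the difference [K - m] is the
    number of components lost when [b] is added to the uncontracted graph, and
    [m] is the value of [L] at [b = 1].  Each merger of two components costs one
    unit of length in every colour, whence the term [D * (K - m)]; a
    transposition in [b] that merges nothing makes the bound strict. *)
Lemma dipole_word_bound s b : (2 < D)%N -> dipole_word s ->
  let L := (\sum_(c < D) perm_length (colour_perm s c * b))%N in
  let M := (size s + D * (graph_rank s b - size s))%N in
  [/\ (size s <= graph_rank s b)%N,
      (graph_rank s b <= perm_length b + size s)%N,
      (M <= L)%N &
      (L == M) = (graph_rank s b == perm_length b + size s)%N].
Proof.
move=> D3; elim: s b => [|[[c x] v] s IH] b /=.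
  move=> _; rewrite /graph_rank /graph_space /= span_nil add0v dim_arc_space.
  rewrite (eq_bigr (fun=> perm_length b)) => [|c _]; last first.
    by rewrite /colour_perm big_nil mul1g.
  by rewrite sum_nat_const card_ord !addn0 add0n subn0 !eqxx !leqnn.
case/and3P => /= xv fv gs.
have sumc f : (\sum_(c' < D) f c' = f c + \sum_(c' < D | c' != c) f c')%N.
  by rewrite (bigD1 c).
have cpc : colour_perm ((c, x, v) :: s) c = tperm x v * colour_perm s c.
  by rewrite colour_perm_cons eqxx.
have cpd c' : c' != c -> colour_perm ((c, x, v) :: s) c' = colour_perm s c'.
  by move=> cc; rewrite colour_perm_cons eq_sym (negPf cc).
(* If b fixes the new vertex, the last dipole contributes one letter, one unit of
   rank and one unit of length, in its own colour. *)
have fixed b1 : b1 v = v ->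
    let s1 := (c, x, v) :: s in
    let L := (\sum_(c < D) perm_length (colour_perm s1 c * b1))%N in
    let M := (size s1 + D * (graph_rank s1 b1 - size s1))%N in
    [/\ (size s1 <= graph_rank s1 b1)%N,
        (graph_rank s1 b1 <= perm_length b1 + size s1)%N,
        (M <= L)%N &
        (L == M) = (graph_rank s1 b1 == perm_length b1 + size s1)%N].
  move=> bv s1 L M; have [h1 h2 h3 h4] := IH b1 gs.
  have rs : graph_rank s1 b1 = (graph_rank s b1).+1 by apply: graph_rank_cons.
  have Ls : L = (\sum_(c < D) perm_length (colour_perm s c * b1)).+1.
    rewrite /L !sumc cpc -addSn; congr (_ + _)%N; last first.
      by apply: eq_bigr => c' cc; rewrite cpd.
    rewrite -mulgA tpermC perm_length_tpermC perm_length_merge //.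
    apply: fixed_notin_porbit; last by rewrite eq_sym.
    by rewrite permM colour_perm_fixed.
  by rewrite Ls /M rs /= subSS addSn eqSS h4 addnS eqSS; split.
have [bv|bv] := eqVneq (b v) v; first exact: fixed.
(* Otherwise the new vertex is cut out of its cycle in b. *)
pose b1 := b * tperm v (b v).
have b1v : b1 v = v := mul_tperm_fixed b v.
have bE : b = b1 * tperm v (b v) by rewrite /b1 -mulgA tperm2 mulg1.
have vb : v != b v by rewrite eq_sym.
have lb : perm_length b = (perm_length b1).+1.
  by rewrite {1}bE perm_length_merge // fixed_notin_porbit.
have := fixed b1 b1v; set s1 := (c, x, v) :: s in cpc cpd *.
rewrite /= !(sumc (fun c => perm_length _)) -/(size s1).
(* In the other colours the vertex v is isolated once b fixes it. *)
have -> : (\sum_(c' < D | c' != c) perm_length (colour_perm s1 c' * b)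
   = \sum_(c' < D | c' != c) perm_length (colour_perm s1 c' * b1) + D.-1)%N.
  transitivity
    (\sum_(c' < D | c' != c) (perm_length (colour_perm s1 c' * b1) + 1))%N.
    apply: eq_bigr => c' cc; rewrite {1}bE mulgA perm_length_merge ?addn1 //.
    by rewrite fixed_notin_porbit // permM cpd // colour_perm_fixed.
  rewrite big_split /= sum_nat_const muln1; congr (_ + _)%N.
  by rewrite (eq_card (B := predC1 c)) // cardC1 card_ord.
set L' := (\sum_(c' < D | _) _)%N.
have rE : graph_rank s1 b =
    (graph_rank s1 b1 + (edge_vec v (b v) \notin graph_space s1 b1))%N.
  by rewrite /graph_rank (graph_space_split s1 b v) dim_add_line.
rewrite rE lb; case: (boolP (_ \in _)) => [dU|dU] /=.
  (* b1 has the same components: a gain of at least D - 2 > 0, so equality is excluded. *)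
  rewrite !addn0 => -[h1 h2 h3 h4].
  have := leq_perm_length_tperm (colour_perm s1 c * b1) v (b v).
  rewrite -mulgA -bE => h5.
  have := D3; move: h1 h2 h3; set k := (D * _)%N; move: h5.
  set l := perm_length (_ * b); set l1 := perm_length (_ * b1).
  by move=> *; split; lia.
(* b1 has one more component: colour c gains too, and equality is transported. *)
rewrite -[colour_perm s1 c * b](_ :
  colour_perm s1 c * b1 * tperm v (b v) = _); last first.
  by rewrite -mulgA -bE.
rewrite perm_length_merge; last by apply: contra dU; apply: porbit_graph_space.
move=> [h1 h2 h3 h4].
have -> : (D * (graph_rank s1 b1 + 1 - (size s).+1)
           = D * (graph_rank s1 b1 - (size s).+1) + D)%N.
  by rewrite -mulnSr; congr (_ * _)%N; lia.
move: h1 h2 h3 h4 D3; set k := (D * _)%N; set l1 := perm_length (_ * b1).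
by move=> *; split; lia.
Qed.

End DipoleWords.

(** * Encoding dipole-built graphs by words *)

Section WordMaps.
Variables (D : nat) (X Y : finType) (h : X -> Y).
Hypothesis h_inj : injective h.
Implicit Types s : seq ('I_D * X * X).

Definition map_word s : seq ('I_D * Y * Y) :=
  [seq (t.1.1, h t.1.2, h t.2) | t <- s].

Lemma map_dipole_word s : dipole_word (map_word s) = dipole_word s.
Proof.
elim: s => [|t s IH] //=; rewrite IH (inj_eq h_inj); congr [&& _, _ & _].
rewrite /fresh_vertex all_map; apply: eq_all => u /=.
by rewrite !(inj_eq h_inj).
Qed.

Lemma map_colour_perm s c x :
  colour_perm (map_word s) c (h x) = h (colour_perm s c x).
Proof.
elim: s x => [|t s IH] x; first by rewrite /colour_perm !big_nil !perm1.
rewrite /= !colour_perm_cons /=; case: ifP => _; last exact: IH.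
by rewrite !permM -IH (inj_tperm _ _ _ h_inj).
Qed.

Lemma fresh_map_word s y : (forall x, h x != y) -> fresh_vertex y (map_word s).
Proof.
by move=> hy; apply/allP => _ /mapP[t _ ->] /=; rewrite ![y == _]eq_sym !hy.
Qed.

End WordMaps.

Section WordCat.
Variables (D : nat) (X : finType).
Implicit Types s : seq ('I_D * X * X).

Lemma colour_perm_cat s1 s2 c :
  colour_perm (s1 ++ s2) c = (colour_perm s1 c * colour_perm s2 c)%g.
Proof. by rewrite /colour_perm big_cat. Qed.

Lemma dipole_word_cat s1 s2 : dipole_word s1 -> dipole_word s2 ->
  {in s1, forall t, fresh_vertex t.2 s2} -> dipole_word (s1 ++ s2).
Proof.
move=> + g2; elim: s1 => //= t s1 IH /and3P[-> f1 /IH g1] f2.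
rewrite g1 /= => [|u us]; last by apply: f2; rewrite inE us orbT.
rewrite andbT /fresh_vertex all_cat; apply/andP; split=> //.
by apply: f2; rewrite inE eqxx.
Qed.

End WordCat.

(** An identification of the black and of the white vertices of [G] with one set
    [X] for which the colour permutations come from a dipole word.  The inverse
    maps are stored because all later constructions use them. *)
Record presentation (D : nat) (G : cgraph D) (X : finType) := Presentation {
  mark : X -> black G;
  mark_inv : black G -> X;
  partner : X -> white G;
  partner_inv : white G -> X;
  word : seq ('I_D * X * X);
  markK : cancel mark mark_inv;
  mark_invK : cancel mark_inv mark;
  partnerK : cancel partner partner_inv;
  partner_invK : cancel partner_inv partner;
  word_dipole : dipole_word word;
  edge_word : forall c x, edge G c (mark x) = partner (colour_perm word c x) }.

(** This relaxes [melonic] and also covers the universal graphs: where the dipoles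
    are inserted has no effect on the limit. *)
Inductive dipole_built (D : nat) : cgraph D -> Prop :=
  | BuiltTwo : dipole_built (two_vertex D)
  | BuiltDipole (G : cgraph D) c (x : black G) :
      dipole_built G -> dipole_built (insert_dipole c x)
  | BuiltIso (G H : cgraph D) :
      cgraph_iso G H -> dipole_built G -> dipole_built H.

Lemma melonic_built D (B : cgraph D) : melonic B -> dipole_built B.
Proof.
case=> _ [s [_ _ iso]]; apply: BuiltIso iso _; rewrite /melon_graph.
have: dipole_built (projT1 (melon0 D)) by exact: BuiltTwo.
elim: (behead s) (melon0 D) => //= -[|c a] r IH M MB; apply: IH => //=.
exact: BuiltDipole.
Qed.

Lemma universal_built p : dipole_built (universal p).
Proof.
rewrite /universal; elim: p.-1 => [|k IH]; first exact: BuiltTwo.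
exact: BuiltDipole.
Qed.

Lemma card_insert_dipole D (G : cgraph D) c (x : black G) :
  #|vertex (insert_dipole c x)| = #|vertex G|.+2.
Proof. by rewrite !card_sum !card_option addSn addnS. Qed.

Lemma universal_card p : (0 < p)%N -> #|vertex (universal p)| = (2 * p)%N.
Proof.
case: p => // p _; rewrite /universal succnK.
elim: p => [|k IH]; first by rewrite card_sum card_unit.
by rewrite card_insert_dipole IH !mulnS.
Qed.

(** Connectedness tested by two-valued colourings of the vertices; unlike a
    statement about paths, it is inherited along dipole insertions by
    restricting the colouring. *)
Definition edge_connected (D : nat) (G : cgraph D) : Prop :=
  forall (f : black G -> bool) (g : white G -> bool),
    (forall c v, g (edge G c v) = f v) -> forall x y, f x = f y.

Lemma dipole_built_connected D (G : cgraph D) :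
  (1 < D)%N -> dipole_built G -> edge_connected G.
Proof.
move=> D2; elim=> {G} [|G c x _ IH|G H [f [g [f_bij g_bij fg]]] _ IH].
- by move=> f g _ [] [].
- move=> f g fg.
  have [c' cc'] : exists c', c' != c.
    exists (if c == Ordinal D2 then Ordinal (ltnW D2) else Ordinal D2).
    by case: ifP => [/eqP->|/negbT]; rewrite // eq_sym.
  (* The three values at the ends of the new edges agree, so the deleted edge at x
     is again respected; this needs a second colour between the new vertices. *)
  have gN : g None = f None.
    by rewrite -(fg c' None) /= /dipole_edge (negPf cc').
  have gx : g None = f (Some x).
    by rewrite -(fg c (Some x)) /= /dipole_edge !eqxx.
  have fx y z : f (Some y) = f (Some z).
    apply: (IH (f \o Some) (g \o Some)) => d v /=.
    have [->|vx] := eqVneq v x; last first.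
      rewrite -(fg d (Some v)) /= /dipole_edge.
      by case: eqP => [->|_] //=; rewrite (negPf vx).
    have [->|dc] := eqVneq d c; last first.
      by rewrite -(fg d (Some x)) /= /dipole_edge (negPf dc).
    by rewrite -gx gN -(fg c None) /= /dipole_edge eqxx.
  have fN y : f y = f (Some x) by case: y => [y|]; rewrite -?gN.
  by move=> y z; rewrite fN -(fN z).
- move=> f' g' fg'.
  case: f_bij => h fK hK x y; rewrite -[x]hK -[y]hK.
  apply: (IH (f' \o f) (g' \o g)) => c v /=; by rewrite -fg fg'.
Qed.

Lemma presentation_two D : exists P : presentation (two_vertex D) unit,
  (size (word P)).+1 = #|{: unit}|.
Proof.
have tt1 : cancel (fun _ : unit => tt) (fun _ : unit => tt) by case.
exists (@Presentation D (two_vertex D) unit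
  (fun=> tt) (fun=> tt) (fun=> tt) (fun=> tt) [::] tt1 tt1 tt1 tt1 isT (fun _ _ => erefl)).
by rewrite card_unit.
Qed.

Lemma presentation_dipole D (G : cgraph D) (X : finType)
    (P : presentation G X) c (x : black G) :
  exists Q : presentation (insert_dipole c x) (option X),
    size (word Q) = (size (word P)).+1.
Proof.
pose s := (c, Some (mark_inv P x), None) :: map_word Some (word P).
have omapK (A B : Type) (f : A -> B) g : cancel f g -> cancel (omap f) (omap g).
  by move=> fK [a|] //=; rewrite fK.
have someI : injective (@Some X) by move=> ? ? [].
have sD : dipole_word s.
  rewrite /= map_dipole_word // word_dipole fresh_map_word //.
have sE d z : edge (insert_dipole c x) d (omap (mark P) z) =
    omap (partner P) (colour_perm s d z).
  have fN : fresh_vertex None (map_word Some (word P)).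
    exact: fresh_map_word.
  have cS y : colour_perm (map_word Some (word P)) d (Some y) =
      Some (colour_perm (word P) d y).
    by rewrite map_colour_perm.
  rewrite /= /dipole_edge colour_perm_cons /= [c == d]eq_sym.
  case: eqVneq => [dc|_]; last first.
    by case: z => [z|] /=; rewrite ?cS /= ?edge_word // colour_perm_fixed.
  subst d; rewrite permM; case: z => [z|] /=; last first.
    by rewrite tpermR cS /= -edge_word mark_invK.
  rewrite -{1}[x](mark_invK P) (can_eq (markK P)).
  case: eqVneq => [->|zx]; first by rewrite tpermL colour_perm_fixed.
  by rewrite tpermD ?cS /= ?edge_word // eq_sym.
by exists (@Presentation D (insert_dipole c x) (option X) _ _ _ _ s
  (omapK _ _ _ _ (markK P)) (omapK _ _ _ _ (mark_invK P))
  (omapK _ _ _ _ (partnerK P)) (omapK _ _ _ _ (partner_invK P)) sD sE); rewrite /= size_map.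
Qed.

Lemma presentation_iso D (G H : cgraph D) X (P : presentation G X) :
  cgraph_iso G H -> exists Q : presentation H X, word Q = word P.
Proof.
case=> f [g [[f' fK f'K] [g' gK g'K] fg]].
have sE c x : edge H c (f (mark P x)) = g (partner P (colour_perm (word P) c x)).
  by rewrite fg edge_word.
by exists (@Presentation D H X _ _ _ _ _
  (can_comp fK (markK P)) (can_comp (mark_invK P) f'K)
  (can_comp gK (partnerK P)) (can_comp (partner_invK P) g'K) (word_dipole P) sE).
Qed.

Lemma presentation_reindex D (G : cgraph D) (X Y : finType) (P : presentation G X)
    (h : X -> Y) (h' : Y -> X) (hK : cancel h h') (h'K : cancel h' h) :
  exists Q : presentation G Y, size (word Q) = size (word P).
Proof.
have sD : dipole_word (map_word h (word P)).
  by rewrite map_dipole_word ?word_dipole //; apply: can_inj hK.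
have sE c y : edge G c (mark P (h' y)) =
    partner P (h' (colour_perm (map_word h (word P)) c y)).
  by rewrite -{2}[y]h'K map_colour_perm ?hK ?edge_word //; apply: can_inj hK.
by exists (@Presentation D G Y _ _ _ _ _
  (can_comp (markK P) h'K) (can_comp hK (mark_invK P))
  (can_comp (partnerK P) h'K) (can_comp hK (partner_invK P)) sD sE);
  rewrite /= size_map.
Qed.

Lemma presentation_card D (G : cgraph D) (X : finType) (P : presentation G X) :
  #|vertex G| = (2 * #|X|)%N.
Proof.
rewrite card_sum -(bij_eq_card (Bijective (markK P) (mark_invK P))).
by rewrite -(bij_eq_card (Bijective (partnerK P) (partner_invK P))) mul2n addnn.
Qed.

Lemma dipole_built_presentation D (G : cgraph D) p :
  dipole_built G -> #|vertex G| = (2 * p)%N ->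
  exists P : presentation G 'I_p, (size (word P)).+1 = p.
Proof.
move=> GB Gp.
have [X [P sP]] : exists X (P : presentation G X), (size (word P)).+1 = #|X|.
  elim: GB => {G Gp} [|G c x _ [X [P sP]]|G H iso _ [X [P sP]]].
  - by exists unit; apply: presentation_two.
  - have [Q sQ] := presentation_dipole P c x; exists (option X), Q.
    by rewrite sQ sP card_option.
  - by have [Q sQ] := presentation_iso P iso; exists X, Q; rewrite sQ.
have pX : p = #|X|.
  by apply/eqP; rewrite -(eqn_pmul2l (isT : 0 < 2)%N) -Gp (presentation_card P).
rewrite pX.
have [Q sQ] := presentation_reindex P (@enum_rankK X) (@enum_valK X).
by exists Q; rewrite sQ.
Qed.

Section DisjointUnionPresentation.
Variables (D n : nat) (hn : (0 < n)%N) (B : 'I_n -> cgraph D) (p : 'I_n -> nat).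
Variable P : forall i, presentation (B i) 'I_(p i).
Let X := {i : 'I_n & 'I_(p i)}.
Let tag_in i : 'I_(p i) -> X := Tagged (fun i => 'I_(p i)).

Let tag_in_inj i : injective (@tag_in i).
Proof. by move=> x y /eqP; rewrite /tag_in eq_Tagged => /eqP. Qed.

Let words (r : seq 'I_n) : seq ('I_D * X * X) :=
  flatten [seq map_word (@tag_in i) (word (P i)) | i <- r].

Let fresh_words r x : tag x \notin r -> fresh_vertex x (words r).
Proof.
move=> xr; apply/allP => t /flattenP[_ /mapP[i ir ->] /mapP[u _ ->]] /=.
have xN (z : 'I_(p i)) : x != tag_in z.
  by apply: contraNneq xr => ->; exact: ir.
by rewrite !xN.
Qed.

Let words_dipole r : uniq r -> dipole_word (words r).
Proof.
elim: r => //= i r IH /andP[ir ur]; apply: dipole_word_cat (IH ur) _.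
  by rewrite map_dipole_word ?word_dipole //; apply: tag_in_inj.
by move=> _ /mapP[t _ ->]; apply: fresh_words.
Qed.

Let words_colour_perm r c i x : uniq r -> i \in r ->
  colour_perm (words r) c (tag_in x) = tag_in (colour_perm (word (P i)) c x).
Proof.
elim: r => //= k r IH /andP[kr ur]; rewrite inE /words /= colour_perm_cat permM.
case: eqVneq => [ik _|ik ir].
  subst k; rewrite map_colour_perm; last exact: tag_in_inj.
  by rewrite colour_perm_fixed //; apply: fresh_words.
rewrite (colour_perm_fixed _ (v := tag_in x)) ?IH //.
apply: fresh_map_word => z; apply: contraNneq ik => e.
by have := congr1 tag e => /= ->.
Qed.

Definition tag_map (T1 T2 : 'I_n -> Type) (f : forall i, T1 i -> T2 i)
  (x : {i & T1 i}) : {i & T2 i} := Tagged T2 (f (tag x) (tagged x)).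

Lemma tag_mapK (T1 T2 : 'I_n -> Type) (f : forall i, T1 i -> T2 i) g :
  (forall i, cancel (f i) (g i)) -> cancel (tag_map f) (tag_map g).
Proof. by move=> fK [i x]; rewrite /tag_map /= fK. Qed.

(** The letters of different blocks act on disjoint sets, so the words of the
    blocks can be concatenated. *)
Lemma presentation_dunion : exists Q : presentation (dunion hn B) X,
  [/\ size (word Q) = (\sum_i size (word (P i)))%N,
      forall x, tag (mark Q x) = tag x & forall x, tag (partner Q x) = tag x].
Proof.
have sE c x : edge (dunion hn B) c (tag_map (fun i => mark (P i)) x) =
    tag_map (fun i => partner (P i)) (colour_perm (words (enum 'I_n)) c x).
  case: x => i x; rewrite -/(tag_in x) words_colour_perm ?enum_uniq ?mem_enum //.
  by rewrite /tag_map /= /dunion_edge /= edge_word.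
exists (@Presentation D (dunion hn B) X _ _ _ _ _
  (tag_mapK (fun i => markK (P i))) (tag_mapK (fun i => mark_invK (P i)))
  (tag_mapK (fun i => partnerK (P i))) (tag_mapK (fun i => partner_invK (P i)))
  (words_dipole (enum_uniq _)) sE); split=> //=.
rewrite /words size_flatten /shape -map_comp sumnE big_map big_enum /=.
by apply: eq_bigr => i _; rewrite size_map.
Qed.

End DisjointUnionPresentation.

(** * Wick contractions as permutations *)

Lemma fcard_porbits (X : finType) (s : {perm X}) : fcard s X = #|porbits s|.
Proof.
have fcE x y : fconnect s x y = (y \in porbit s x).
  apply/idP/porbitP => [/iter_findex<-|[i ->]].
    by exists (findex s x y); rewrite permX.
  by rewrite permX fconnect_iter.
have symc : connect_sym (frel s) := fconnect_sym perm_inj.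
rewrite /n_comp_mem /porbits.
rewrite -(card_in_imset (f := porbit s) (D := [predI froots s & X])).
  congr #|pred_of_set _|; apply/setP => A; apply/imsetP/imsetP => -[x _ ->].
    by exists x.
  exists (froot s x); first by rewrite !inE roots_root.
  by apply/eqP; rewrite eq_porbit_mem porbit_sym -fcE connect_root.
move=> x y /andP[/eqP rx _] /andP[/eqP ry _] /eqP.
by rewrite eq_porbit_mem -fcE symc => /(fingraph.rootP symc); rewrite rx ry.
Qed.

Lemma connected_graphP D (G : cgraph D.+1) :
  reflect (edge_connected G) (connected_graph G).
Proof.
have symc : connect_sym (@adj _ G xpredT).
  by apply: sym_connect_sym; apply: adj_sym.
apply: (iffP idP) => [/forallP conn f g fg x y|conn].
  pose a : pred (vertex G) :=
    fun z => match z with inl v => f v | inr w => g w end.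
  have cl_a : fingraph.closed (@adj _ G xpredT) a.
    move=> [v|w] [v'|w'] //= /existsP[c /eqP E].
      by rewrite -!topredE /= -E fg.
    by rewrite -!topredE /= -E fg.
  have := closed_connect cl_a (forallP (conn (inl x)) (inl y)).
  by rewrite -!topredE.
have inv (x : vertex G) c v :
    connect (@adj _ G xpredT) x (inr (edge G c v)) =
    connect (@adj _ G xpredT) x (inl v).
  apply: same_connect_r => //; apply: connect1.
  by apply/existsP; exists c; rewrite /= eqxx.
apply/forallP => x; apply/forallP => y.
have [v xv] : exists v, connect (@adj _ G xpredT) x (inl v).
  case: x => [v|w]; first by exists v.
  case: (edge_bij G ord0) => h _ hK; exists (h w).
  by rewrite -(inv _ ord0) hK.
have all v' : connect (@adj _ G xpredT) x (inl v').
  have := conn (fun v => connect (@adj _ G xpredT) x (inl v))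
    (fun w => connect (@adj _ G xpredT) x (inr w)) (fun c v => inv x c v) v' v.
  by rewrite xv.
case: y => [v'|w] //; case: (edge_bij G ord0) => h _ hK.
by rewrite -[w]hK inv.
Qed.

Section Contraction.
Variables (D : nat) (G : cgraph D) (X : finType) (Q : presentation G X).
Implicit Types b : {perm X}.

(** The contraction that joins the black vertex [b x] to the white vertex [x]; with
    this orientation the faces are cycles of products [colour_perm * b]. *)
Definition wick_fun b : {ffun black G -> white G} :=
  [ffun v => partner Q ((b^-1)%g (mark_inv Q v))].

Lemma wick_fun_wick b : is_wick (wick_fun b).
Proof.
apply/andP; split.
  apply/injectiveP => x y; rewrite !ffunE => /(can_inj (partnerK Q)) /perm_inj.
  exact: (can_inj (mark_invK Q)).
apply/forallP => w; apply/codomP; exists (mark Q (b (partner_inv Q w))).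
by rewrite ffunE markK permK partner_invK.
Qed.

Definition wick_of b : wick G := exist _ (wick_fun b) (wick_fun_wick b).

Lemma wick_of_mark b (x : X) : val (wick_of b) (mark Q (b x)) = partner Q x.
Proof. by rewrite /= ffunE markK permK. Qed.

Lemma wick_of_bij : bijective wick_of.
Proof.
have inj (pi : wick G) : injective (fun x => partner_inv Q (val pi (mark Q x))).
  move=> x y /(can_inj (partner_invK Q)) /(bij_inj (wick_bij pi)).
  exact: (can_inj (markK Q)).
exists (fun pi => ((perm (@inj pi))^-1)%g) => [b|pi].
  apply/permP => x; apply: (canLR (permK _)); rewrite permE.
  by rewrite wick_of_mark partnerK.
apply: val_inj; apply/ffunP => v; rewrite ffunE invgK permE.
by rewrite mark_invK partner_invK.
Qed.

Lemma contract_edge0 b x :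
  edge (Defs.contract (wick_of b)) ord0 (mark Q (b x)) = partner Q x.
Proof. by rewrite /= /contract_edge unlift_none wick_of_mark. Qed.

Lemma contract_edge_lift (pi : wick G) c :
  edge (Defs.contract pi) (lift ord0 c) =1 edge G c.
Proof. by move=> v; rewrite /= /contract_edge liftK. Qed.

(** Starting at a black vertex and following the edge of colour [c] and then the
    edge of colour 0 applies [colour_perm c] and then [b]; a face visits its black
    vertices by iterating this. *)
Lemma face_count b c :
  n_comp (@adj _ (Defs.contract (wick_of b)) (pred2 ord0 (lift ord0 c))) predT
  = #|porbits (colour_perm (word Q) c * b)%g|.
Proof.
pose C := Defs.contract (wick_of b).
set e := adj _; set s := (_ * b)%g.
have symc : connect_sym e by apply: sym_connect_sym; apply: adj_sym.
have syms : connect_sym (frel s) := fconnect_sym perm_inj.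
pose h (x : X) : vertex C := inl (mark Q x).
have e0 x : e (h (b x)) (inr (partner Q x)).
  by apply/existsP; exists ord0; rewrite contract_edge0 eqxx.
have ec x : e (h x) (inr (partner Q (colour_perm (word Q) c x))).
  apply/existsP; exists (lift ord0 c).
  by rewrite contract_edge_lift edge_word /= !eqxx ?orbT ?andbT.
pose h' (z : vertex C) : X := match z with
  | inl v => mark_inv Q v
  | inr w => (colour_perm (word Q) c)^-1%g (partner_inv Q w) end.
have step v w : e (inl v) (inr w) -> fconnect s (mark_inv Q v) (h' (inr w)).
  case/existsP => d /andP[/orP[]/eqP-> /eqP <-].
    have [z ->] : exists z, v = mark Q (b z).
      by exists ((b^-1)%g (mark_inv Q v)); rewrite permKV mark_invK.
    rewrite contract_edge0 /= partnerK markK syms; apply: connect1; apply/eqP.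
    by rewrite permM permKV.
  rewrite contract_edge_lift /= -{2}[v](mark_invK Q) edge_word partnerK permK.
  exact: connect0.
rewrite -fcard_porbits (adjunction_n_comp h symc syms) //.
apply: (intro_adjunction syms _ (fun z _ => h' z)) => [//|z _|x _].
  split=> [|z' _].
    case: z => [v|w]; first by rewrite /h /= mark_invK.
    rewrite symc connect1 //.
    by have := ec (h' (inr w)); rewrite permKV partner_invK.
  case: z z' => [v|w] [v'|w'] //; first exact: step.
  by rewrite syms => ?; apply: step.
split=> [|y /eqP <-]; first by rewrite /= markK.
by rewrite permM (connect_trans (connect1 (ec x))) // symc connect1.
Qed.

Lemma num_faces_wick_of b : num_faces (Defs.contract (wick_of b))
  = (\sum_(c < D) #|porbits (colour_perm (word Q) c * b)%g|)%N.
Proof. by apply: eq_bigr => c _; apply: face_count. Qed.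

Lemma graph_rank_connected b : connected_graph (Defs.contract (wick_of b)) ->
  (graph_rank (word Q) b).+1 = #|X|.
Proof.
move/connected_graphP => conn.
have [x0 _] : exists x0 : X, true.
  have /card_gt0P[[v|w] _] := cgraph_nonempty G; first by exists (mark_inv Q v).
  by exists (partner_inv Q w).
have all x : edge_vec x0 x \in graph_space (word Q) b.
  have := conn (fun v => edge_vec x0 (mark_inv Q v) \in graph_space (word Q) b)
    (fun w => edge_vec x0 (partner_inv Q w) \in graph_space (word Q) b) _
    (mark Q x0) (mark Q x).
  rewrite !markK edge_vecxx mem0v => <- // c v.
  have sub y z : edge_vec y z \in graph_space (word Q) b ->
      (edge_vec x0 y \in graph_space (word Q) b) =
      (edge_vec x0 z \in graph_space (word Q) b).
    move=> yz; rewrite -(edge_vec_trans x0 y z).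
    apply/idP/idP => h; first exact: memvD.
    by rewrite -[edge_vec x0 y](addrK (edge_vec y z)) memvB.
  rewrite -[v](mark_invK Q); case: (unliftP ord0 c) => [d ->|->].
    rewrite contract_edge_lift edge_word partnerK markK.
    by apply/esym/sub/colour_arc_mem.
  rewrite -[mark_inv Q v](permKV b) contract_edge0 partnerK markK.
  exact/sub/perm_arc_mem.
apply: (dim_connected x0 _ (graph_space_augmentation _ _)) => x y.
by rewrite -(edge_vec_trans x x0 y) memvD // -edge_vecN memvN.
Qed.

End Contraction.

(** The contraction joins all the blocks: no proper nonempty set of blocks is
    preserved by [b].  The blocks being connected, this is the connectedness of
    the contracted graph, and it does not mention their inner structure. *)
Definition block_connected (n : nat) (T : 'I_n -> finType)
    (b : {perm {i : 'I_n & T i}}) : bool :=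
  [forall J : {set 'I_n}, [forall x, (tag (b x) \in J) == (tag x \in J)] ==>
     ((J == finset.set0) || (J == finset.setT))].

Lemma connected_wick_of D n (hn : (0 < n)%N) (B : 'I_n -> cgraph D) (T : 'I_n -> finType)
    (Q : presentation (dunion hn B) {i : 'I_n & T i}) b :
    (0 < D)%N -> (forall i, edge_connected (B i)) ->
    (forall x, tag (mark Q x) = tag x) -> (forall x, tag (partner Q x) = tag x) ->
  connected_graph (Defs.contract (wick_of Q b)) = block_connected b.
Proof.
move=> D0 Bconn tagm tagp.
have tagmi v : tag (mark_inv Q v) = tag v by rewrite -tagm mark_invK.
have Tne i : exists x : T i, true.
  have /card_gt0P[[v|w] _] := cgraph_nonempty (B i).
    have := tagmi (Tagged (fun i => black (B i)) v).
    by case: (mark_inv _ _) => j x /= <-; exists x.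
  have := tagp (partner_inv Q (Tagged (fun i => white (B i)) w)).
  by rewrite partner_invK; case: (partner_inv _ _) => j x /= ->; exists x.
apply/connected_graphP/forallP => [conn J|blk f g fg].
  apply/implyP => /forallP Jb.
  have sameJ i k : (i \in J) = (k \in J).
    have [x _] := Tne i; have [y _] := Tne k.
    have := conn (fun v => tag v \in J) (fun w => tag w \in J) _
      (mark Q (Tagged T x)) (mark Q (Tagged T y)).
    rewrite !tagm; apply => c v; case: (unliftP ord0 c) => [d ->|->].
      by rewrite contract_edge_lift.
    have -> : v = mark Q (b ((b^-1)%g (mark_inv Q v))) by rewrite permKV mark_invK.
    by rewrite contract_edge0 tagp tagm; apply/esym/eqP/Jb.
  have [->|[i iJ]] := set_0Vmem J; first by rewrite eqxx.
  by apply/orP; right; apply/eqP/setP => k; rewrite inE (sameJ k i).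
have fblock (v v' : black (dunion hn B)) : tag v = tag v' -> f v = f v'.
  case: v v' => [i v] [k v'] /= ik; subst k.
  apply: (Bconn i (fun v => f (Tagged (fun i => black (B i)) v))
    (fun w => g (Tagged (fun i => white (B i)) w))) => c u.
  by rewrite -(fg (lift ord0 c)) contract_edge_lift.
have gblock x : g (partner Q x) = f (mark Q x).
  case: (edge_bij (dunion hn B) (Ordinal D0)) => h _ hK.
  rewrite -[partner Q x]hK -(@contract_edge_lift _ _ (wick_of Q b)) fg.
  by apply: fblock; rewrite tagm -(tagp x) -[in RHS](hK (partner Q x)).
pose J := [set i : 'I_n | [exists x : T i, f (mark Q (Tagged T x))]].
have JE x : (tag x \in J) = f (mark Q x).
  rewrite inE; apply/existsP/idP => [[y fy]|fx].
    by rewrite -(fblock _ _ _ : f (mark Q (Tagged T y)) = _) // !tagm.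
  by case: x fx => i x fx; exists x.
have Jb : [forall x, (tag (b x) \in J) == (tag x \in J)].
  apply/forallP => x; rewrite !JE -(fg ord0) contract_edge0 gblock.
  exact: eqxx.
case/orP: (implyP (blk J) Jb) => /eqP Jtriv.
- by move=> x y; rewrite -[x](mark_invK Q) -[y](mark_invK Q) -!JE Jtriv !inE.
by move=> x y; rewrite -[x](mark_invK Q) -[y](mark_invK Q) -!JE Jtriv !inE.
Qed.

(** * The large N limit *)

Section Limit.
Local Open Scope classical_set_scope.
Local Open Scope ring_scope.

Lemma cvg_finite_sum (R : realType) (I : Type) (r : seq I) (P : pred I)
    (f : I -> nat -> R) (l : I -> R) :
  (forall i, f i N @[N --> \oo] --> l i) ->
  \sum_(i <- r | P i) f i N @[N --> \oo] --> \sum_(i <- r | P i) l i.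
Proof.
move=> fl; elim: r => [|i r IH].
  by under eq_fun do rewrite big_nil; rewrite big_nil; apply: cvg_cst.
under eq_fun do rewrite big_cons; rewrite big_cons.
by case: (P i) => //; apply: cvgD.
Qed.

Lemma cvg_powRN_nat (R : realType) (m : nat) :
  (N%:R `^ (- m%:R) : R) @[N --> \oo] --> ((m == 0)%:R : R).
Proof.
have E (N : nat) : N%:R `^ (- m%:R) = (N%:R^-1) ^+ m :> R.
  by rewrite powRN powR_mulrn ?ler0n // exprVn.
under eq_fun do rewrite E; rewrite -expr0n.
elim: m {E} => [|m IH]; first by under eq_fun do rewrite expr0; apply: cvg_cst.
under eq_fun do rewrite exprS; rewrite exprS; apply: cvgM IH.
apply/gtr0_cvgV0; last exact: cvgr_idn.
by near=> N; rewrite ltr0n; near: N; exists 1%N.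
Unshelve. all: by end_near. Qed.

(** Joining [n] blocks takes length at least [n - 1]; in the extremal case, the
    cycles of [b] are the hyperedges of a hypertree on the blocks. *)
Definition tree_like (n : nat) (p : 'I_n -> nat)
    (b : {perm {i : 'I_n & 'I_(p i)}}) : bool :=
  block_connected b && ((perm_length b).+1 == n)%N.

(** After the rescaling, the contraction of [b] contributes [N ^ (- m b)], where
    [m b] is the defect in [dipole_word_bound]; the limit counts the [b] without
    defect. *)
Lemma conn_integral_limit (R : realType) (D n : nat) (hn : (0 < n)%N)
    (B : 'I_n -> cgraph D) (p : 'I_n -> nat) :
    (2 < D)%N -> (forall i, #|vertex (B i)| = (2 * p i)%N) ->
    (forall i, dipole_built (B i)) ->
  (N%:R `^ ((D%:R - 1) * n%:R - D%:R) * conn_integral R N hn B) @[N --> \oo] -->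
    (#|@tree_like n p|%:R : R).
Proof.
move=> D3 Bp BB.
pose P i := sval (cid (dipole_built_presentation (BB i) (Bp i))).
have sP i : (size (word (P i))).+1 = p i :=
  svalP (cid (dipole_built_presentation (BB i) (Bp i))).
have [Q [sQ tagm tagp]] := presentation_dunion hn P.
pose X := {i : 'I_n & 'I_(p i)} : finType.
have sX : (size (word Q) + n = #|X|)%N.
  rewrite sQ card_tagged sumnE big_map big_enum /=.
  transitivity (\sum_(i < n) (size (word (P i)) + 1))%N.
    by rewrite big_split /= sum1_card card_ord.
  by apply: eq_bigr => i _; rewrite card_ord addn1 sP.
have conn b : connected_graph (Defs.contract (wick_of Q b)) = block_connected b.
  apply: connected_wick_of => //; first by lia.
  by move=> i; apply: dipole_built_connected (BB i); lia.
pose L (b : {perm X}) :=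
  (\sum_(c < D) perm_length (colour_perm (word Q) c * b)%g)%N.
pose m b := (L b - (size (word Q) + D * n.-1))%N.
have bound b : block_connected b ->
    (size (word Q) + D * n.-1 <= L b)%N /\ (m b == 0)%N = tree_like b.
  move=> bb; have rX : (graph_rank (word Q) b).+1 = #|X|.
    by apply: graph_rank_connected; rewrite conn.
  have [h1 h2 h3 h4] := dipole_word_bound b D3 (word_dipole Q).
  have rn : (graph_rank (word Q) b - size (word Q) = n.-1)%N by lia.
  rewrite rn in h3 h4; split=> //; rewrite /tree_like bb /= /m subn_eq0.
  rewrite -[(L b <= _)%N]andbT -h3 -eqn_leq h4.
  have arith (k z x l q : nat) : k.+1 = x -> (z + q = x)%N ->
    (k == l + z)%N = (l.+1 == q) by lia.
  exact: arith rX sX.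
have faces b : (num_faces (Defs.contract (wick_of Q b)) + L b = D * #|X|)%N.
  rewrite num_faces_wick_of /L -big_split /=.
  transitivity (\sum_(c < D) #|X|)%N; last by rewrite sum_nat_const card_ord.
  by apply: eq_bigr => c _; rewrite /perm_length subnKC // leq_card_porbits.
have -> : (#|@tree_like n p|%:R : R) =
    \sum_(b : {perm X} | block_connected b) (m b == 0)%:R.
  rewrite -sum1_card natr_sum big_mkcond [RHS]big_mkcond /=.
  apply: eq_bigr => b _; rewrite -topredE /=.
  case bb : (block_connected b); last by rewrite /tree_like bb.
  by have [_ ->] := bound b bb; case: (tree_like b).
have lim := @cvg_finite_sum R _ (index_enum {perm X})
  (fun b => block_connected b) _ _ (fun b => @cvg_powRN_nat R (m b)).
apply: cvg_trans lim.
apply: near_eq_cvg; near=> N.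
have N0 : (N%:R : R) != 0 by rewrite pnatr_eq0 -lt0n; near: N; exists 1%N.
rewrite /conn_integral /= (reindex _ (onW_bij _ (wick_of_bij Q))) mulr_sumr.
rewrite (eq_bigl _ _ conn); apply: eq_bigr => b bb.
rewrite -powRD ?N0 ?implybT //; congr (_ `^ _).
have [h _] := bound b bb; have := faces b.
rewrite (presentation_card Q) natrM => F.
have : (num_faces (Defs.contract (wick_of Q b)) + #|X| + D * n + m b
        = D * #|X| + n + D)%N.
  have Dn : (D * n = D * n.-1 + D)%N by rewrite -mulnSr; congr (_ * _)%N; lia.
  by move: h F sX; rewrite Dn /m; lia.
move/(congr1 (fun k => k%:R : R)); rewrite !natrD !natrM => E.
lra.
Unshelve. all: by end_near. Qed.

End Limit.

Unset Implicit Arguments.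
Local Open Scope classical_set_scope.
Local Open Scope ring_scope.

Theorem theorem4p2 (R : realType) (D n : nat) (hD : (3 <= D)%N)
    (hn : (0 < n)%N) (B : 'I_n -> cgraph D) (p : 'I_n -> nat)
    (hp : forall i, #|vertex (B i)| = (2 * p i)%N)
    (hB : forall i, melonic (B i)) :
  (Delta R N hn B p @[N --> \oo] --> (0 : R)) /\
  (forall (D' : nat) (hD' : (3 <= D')%N) (B' : 'I_n -> cgraph D')
      (hp' : forall i, #|vertex (B' i)| = (2 * p i)%N)
      (hB' : forall i, melonic (B' i)),
    (N%:R `^ ((D%:R - 1) * n%:R - D%:R) * conn_integral R N hn B
     - N%:R `^ ((D'%:R - 1) * n%:R - D'%:R) * conn_integral R N hn B')
      @[N --> \oo] --> (0 : R)).
Proof.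
have lim D1 (C : 'I_n -> cgraph D1) : (2 < D1)%N ->
    (forall i, #|vertex (C i)| = (2 * p i)%N) -> (forall i, melonic (C i)) ->
  (N%:R `^ ((D1%:R - 1) * n%:R - D1%:R) * conn_integral R N hn C)
    @[N --> \oo] --> (#|@tree_like n p|%:R : R).
  move=> D13 Cp Cmel; apply: conn_integral_limit => // i.
  exact: melonic_built.
have cancel_lim (u v : nat -> R) (l : R) :
    u N @[N --> \oo] --> l -> v N @[N --> \oo] --> l ->
    (u N - v N) @[N --> \oo] --> (0 : R).
  by move=> ul vl; rewrite -(subrr l); apply: cvgB.
split=> [|D' hD' B' hp' hB']; last first.
  by apply: (cancel_lim _ _ _ (lim D B hD hp hB) (lim D' B' hD' hp' hB')).
have p_gt0 i : (0 < p i)%N.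
  have : (0 < #|vertex (B i)|)%N := cgraph_nonempty (B i).
  by rewrite hp muln_gt0.
have ulim := @conn_integral_limit R 3 n hn (fun i => universal (p i)) p isT
  (fun i => universal_card (p_gt0 i)) (fun i => universal_built (p i)).
have two : 3%:R - 1 = 2%:R :> R by lra.
rewrite two in ulim.
exact: (cancel_lim _ _ _ (lim D B hD hp hB) ulim).
Qed.
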